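(* Let $n\in2\mathbb{Z}_{\ge0}$. Then the following hold. (1) If $n\equiv0\pmod 4$, then $P_{\frac n2}(s;n)=n!$ for all $s\in\mathbb{C}$. (2) If $n\equiv2\pmod 4$, then the values of $P_{\frac n2}(s;n)$ for $s=\pm1,\pm5,\ldots,\pm(n-1)$ are $$P_{\frac n2}(s;n)=\begin{cases} n! & \text{if } s=1,5,9,\ldots,n-1,\\ -n! & \text{if } s=-1,-5,-9,\ldots,-(n-1).\end{cases}$$
   Context: Put $a(x)=2x(2x-1)$. $P_0(x;y)=1$, and for $k\ge1$, $P_k(x;y)$ is the determinant of the $k\times k$ tridiagonal matrix with diagonal entries $(y-4(i-1))x$ in position $(i,i)$ $(1\le i\le k)$, entries $a(i)$ in position $(i,i+1)$, and entries $-a\left(\frac{y-2i+2}{2}\right)$ in position $(i+1,i)$ $(1\le i\le k-1)$. *)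

(* Defs.v *)
From HB Require Import structures.
From mathcomp Require Import all_boot all_order all_algebra.

Set Implicit Arguments.
Unset Strict Implicit.
Unset Printing Implicit Defensive.

Import GRing.Theory.
Local Open Scope ring_scope.

Definition a (F : fieldType) (x : F) : F := 2 * x * (2 * x - 1).

(* Ordinals start at 0, so the row called i in the usual 1-based description
   of the matrix is i.+1 here. *)
Definition tridiag (F : fieldType) (k : nat) (x y : F) : 'M[F]_k :=
  \matrix_(i < k, j < k)
    if j == i :> nat then (y - 4 * (i.+1%:R - 1)) * x
    else if j == i.+1 :> nat then a i.+1%:R
    else if i == j.+1 :> nat then - a ((y - 2 * j.+1%:R + 2) / 2)
    else 0.

(* The determinant of the empty matrix is 1 (det_mx00), so P 0 x y = 1. *)
Definition P (F : fieldType) (k : nat) (x y : F) : F := \det (tridiag k x y).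

(* Main.v *)
Require Import Defs.
From HB Require Import structures.
From mathcomp Require Import all_boot all_order all_algebra.
From mathcomp Require Import complex reals.
From mathcomp Require Import zify ring.

Set Implicit Arguments.
Unset Strict Implicit.
Unset Printing Implicit Defensive.

Import Order.TTheory GRing.Theory Num.Theory.
Local Open Scope ring_scope.

(** Write [n = 2k], and let [E = d/dt], [F = n t - t^2 d/dt], [H = n - 2 t d/dt]
([lower], [raise] and [weight] below) be the standard action of sl2 on the
polynomials in [t] of degree at most [n].  Expanding
the tridiagonal determinant along its last row gives a three-term recurrence
for [P_j(x; n)], and this is exactly the recurrence satisfied by
[(2j)! f_(2j)], where the [f_i] are the coefficients of a polynomial [f]
killed by [E^2 - F^2 - x H].  Hence [(2j)! f_(2j) = f_0 P_j(x; n)]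
(lemma [coef_solution]), and [P_k(x; n) = n!] as soon as a polynomial solution
exists with [f_n = f_0] and [f_0 <> 0].

Such solutions become visible in the eigenbasis of [E + F], which consists of
the polynomials [(1 + t)^p (1 - t)^q] with [p + q = n], of eigenvalue
[w = p - q].  Since [[E, F] = H], one has
[E^2 - F^2 - x H = (E + F) (E - F) + (1 - x) H], and this operator sends the
eigenvector of eigenvalue [w] to a combination of its neighbours of eigenvalues
[w - 2] and [w + 2], with coefficients [p (w - 1 - x)] and [- q (w + 1 + x)].
For [x = n - 4i - 1] with [4i <= n] the first coefficient vanishes at
[w = n - 4i], so a solution supported on [w = n, n - 4, ..., n - 4i] exists,
and its coefficients, products of binomials, are nonnegative and not all zero
([sol], [eqn_op_sol_eq0]).  All exponents [q] being even, each eigenvector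
involved has constant coefficient and coefficient of [t^n] equal to [1], so
[f_n = f_0 > 0].  This proves [P_k(n - 4i - 1; n) = n!] whatever the parity
of [k] ([P_at_special_points]).

Finally [P_k(-x; n) = (-1)^k P_k(x; n)].  For [k] odd this yields the values
[n!] and [- n!].
For [k] even, [P_k(x; n) - n!] is a polynomial in [x] of degree at most [k]
which vanishes at the [k + 2] points [+-(n - 4i - 1)], [0 <= i <= k/2], so it
is zero and [P_k(x; n) = n!] for all [x] ([P_even_order]). *)

(** * Recurrence for the determinants *)

(** Expansion along the last row, then along the last column. *)
Lemma det_tridiagonal_rec (F : comNzRingType) (e : nat -> nat -> F) (k : nat) :
    (forall i j, (j.+1 < i)%N || (i.+1 < j)%N -> e i j = 0) ->
  \det (\matrix_(i < k.+2, j < k.+2) e i j) =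
    e k.+1 k.+1 * \det (\matrix_(i < k.+1, j < k.+1) e i j)
    - e k k.+1 * e k.+1 k * \det (\matrix_(i < k, j < k) e i j).
Proof.
move=> e0.
have bump_lt m i : (i < m)%N -> bump m i = i by rewrite /bump; lia.
have bump_eq m : bump m m = m.+1 by rewrite /bump leqnn.
rewrite (expand_det_row _ ord_max) big_ord_recr big_ord_recr /=.
rewrite big1 ?add0r => [|i _]; last first.
  by rewrite mxE e0 ?mul0r //=; have := ltn_ord i; lia.
rewrite !mxE /= addrC /cofactor /=; congr (_ + _).
  rewrite -signr_odd addnn odd_double mul1r; congr (_ * \det _).
  by apply/matrixP => i j; rewrite !mxE /= !bump_lt.
rewrite (expand_det_col _ ord_max) big_ord_recr /=.
rewrite big1 ?add0r => [|i _]; last first.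
  rewrite !mxE /= bump_eq e0 ?mul0r //.
  by have := ltn_ord i; rewrite /bump; lia.
rewrite !mxE /= bump_eq bump_lt // /cofactor /=.
rewrite -signr_odd oddD /= addNb addbb /= expr1.
rewrite -signr_odd addnn odd_double !mul1r.
rewrite mulN1r mulrN mulrA [e k k.+1 * _]mulrC; congr (- (_ * \det _)).
apply/matrixP => i j; rewrite !mxE /= !(bump_lt k) //.
by rewrite !bump_lt // ltnW // ltnS.
Qed.

Section Recurrence.
Variables (F : fieldType) (x y : F).

Lemma P0 : P 0 x y = 1. Proof. exact: det_mx00. Qed.
Lemma P1 : P 1 x y = y * x.
Proof. by rewrite /P det_mx11 mxE /= subrr mulr0 subr0. Qed.

Lemma P_recurrence k : P k.+2 x y = (y - 4 * k.+1%:R) * x * P k.+1 x y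
  + a k.+1%:R * a ((y - 2 * k.+1%:R + 2) / 2) * P k x y.
Proof.
rewrite /P /tridiag (det_tridiagonal_rec (e := fun i j : nat =>
  if j == i then (y - 4 * (i.+1%:R - 1)) * x
    else if j == i.+1 then a i.+1%:R
    else if i == j.+1 then - a ((y - 2 * j.+1%:R + 2) / 2)
    else 0)) => [|i j]; last first.
  by case: ifP; [lia|case: ifP; [lia|case: ifP => //; lia]].
rewrite !eqxx [k == k.+1]ltn_eqF // [k == k.+2]ltn_eqF // gtn_eqF //.
by rewrite -[k.+2%:R]natr1 addrK mulrN mulNr opprK.
Qed.
End Recurrence.

Lemma nat_ind2 (Q : nat -> Prop) :
  Q 0%N -> Q 1%N -> (forall k, Q k -> Q k.+1 -> Q k.+2) -> forall k, Q k.
Proof.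
move=> Q0 Q1 QS k; suff: Q k /\ Q k.+1 by case.
by elim: k => // k [Qk Qk1]; split=> //; apply: QS.
Qed.

(** In [P_recurrence] the term one step back carries a factor [x] and the term
two steps back does not, so [P k] has the parity of [k] in [x]. *)
Lemma P_opp (F : fieldType) (x y : F) k : P k (- x) y = (-1) ^+ k * P k x y.
Proof.
elim/nat_ind2: k => [||k IH0 IH1]; first by rewrite !P0 mul1r.
  by rewrite !P1; ring.
by rewrite !P_recurrence IH0 IH1 !exprS; ring.
Qed.

Lemma P_polynomial (F : fieldType) (y : F) k :
  exists2 q : {poly F}, (size q <= k.+1)%N & forall x, P k x y = q.[x].
Proof.
elim/nat_ind2: k => [||k [q0 s0 E0] [q1 s1 E1]].
- by exists 1 => [|x]; rewrite ?size_poly1 ?P0 ?hornerE.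
- exists (y *: 'X) => [|x]; last by rewrite P1 !hornerE.
  by rewrite (leq_trans (size_scale_leq _ _)) ?size_polyX.
- exists ((y - 4 * k.+1%:R) *: (q1 * 'X)
      + (a k.+1%:R * a ((y - 2 * k.+1%:R + 2) / 2)) *: q0) => [|x].
    rewrite (leq_trans (size_polyD _ _)) // geq_max.
    rewrite !(leq_trans (size_scale_leq _ _)) //.
      by rewrite (leq_trans s0) // leqW.
    by rewrite (leq_trans (size_polyMleq _ _)) // size_polyX addn2.
  by rewrite P_recurrence E0 E1 hornerD !hornerZ hornerMX; ring.
Qed.

(** * The sl2 equation behind the recurrence *)

Section Equation.
Variables (F : comNzRingType) (n : nat) (x : F).
Implicit Types (f g : {poly F}).

(** The sl2 triple acting on polynomials of degree at most [n], seen as binary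
forms of degree [n] restricted to the affine line. *)
Definition lower f : {poly F} := f^`().
Definition raise f : {poly F} := n%:R * 'X * f - 'X^2 * f^`().
Definition weight f : {poly F} := n%:R * f - 2 * 'X * f^`().
Definition eqn_op f : {poly F} :=
  lower (lower f) - raise (raise f) - x%:P * weight f.

Lemma coef_lower f j : (lower f)`_j = j.+1%:R * f`_j.+1.
Proof. by rewrite coef_deriv mulr_natl. Qed.

Lemma coef_raise0 f : (raise f)`_0 = 0.
Proof.
by rewrite coefB !coef0M coefX /= mulr0 !mul0r subr0.
Qed.

Lemma coef_raiseS f j : (raise f)`_j.+1 = (n%:R - j%:R) * f`_j.
Proof.
rewrite coefB -mulrA -polyC_natr coefCM coefXM coefXnM coef_deriv /=.
case: j => [|j] /=; first by ring.
by rewrite subSS subn1 /=; ring.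
Qed.

Lemma coef_weight f j : (weight f)`_j = (n%:R - 2 * j%:R) * f`_j.
Proof.
rewrite coefB -mulrA -!polyC_natr !coefCM coefXM coef_deriv.
by case: j => [|j] /=; ring.
Qed.

Lemma deriv_nat m : (m%:R : {poly F})^`() = 0.
Proof. by rewrite -polyC_natr derivC. Qed.

(** [E^2 - F^2 = (E + F) (E - F) + [E, F]] with [[E, F] = H]; the factor
[E + F] is the one diagonalised by [eigenvec] below. *)
Lemma eqn_opE f : eqn_op f =
  let g := lower f - raise f in
  lower g + raise g + (1 - x)%:P * weight f.
Proof.
rewrite /eqn_op /lower /raise /weight polyCB polyC1 /=.
rewrite !(derivB, derivM, derivX, derivXn, deriv_nat) /=.
move: (f^`()^`()) (f^`()) (x%:P) ('X : {poly F}) (n%:R : {poly F}) => f2 f1 c X N.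
rewrite expr2; ring.
Qed.

Definition eigenvec (p q : nat) : {poly F} := (1 + 'X) ^+ p * (1 - 'X) ^+ q.

Lemma deriv_eigenvec p q : (eigenvec p q)^`() =
  p%:R * eigenvec p.-1 q - q%:R * eigenvec p q.-1.
Proof.
rewrite /eigenvec derivM !deriv_exp derivB derivD derivX derivC add0r sub0r.
move: ('X : {poly F}) => X; ring.
Qed.

Lemma lower_add_raise_eigenvec p q : (p + q)%N = n ->
  lower (eigenvec p q) + raise (eigenvec p q) =
  (p%:R - q%:R) * eigenvec p q.
Proof.
move=> pqn; rewrite /lower /raise deriv_eigenvec -pqn.
by case: p q {pqn} => [|p] [|q]; rewrite /eigenvec ?exprS /= !natrD; ring.
Qed.

Lemma lower_sub_raise_eigenvec p q : (p + q)%N = n ->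
  lower (eigenvec p q) - raise (eigenvec p q) =
  p%:R * eigenvec p.-1 q.+1 - q%:R * eigenvec p.+1 q.-1.
Proof.
move=> pqn; rewrite /lower /raise deriv_eigenvec -pqn.
by case: p q {pqn} => [|p] [|q]; rewrite /eigenvec ?exprS /= !natrD; ring.
Qed.

Lemma weight_eigenvec p q : (p + q)%N = n -> weight (eigenvec p q) =
  p%:R * eigenvec p.-1 q.+1 + q%:R * eigenvec p.+1 q.-1.
Proof.
move=> pqn; rewrite /weight deriv_eigenvec -pqn.
by case: p q {pqn} => [|p] [|q]; rewrite /eigenvec ?exprS /= !natrD; ring.
Qed.

Fact eqn_op_is_zmod_morphism : zmod_morphism eqn_op.
Proof.
move=> f g; rewrite /eqn_op /lower /raise /weight !(derivB, derivM); ring.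
Qed.
HB.instance Definition _ :=
  GRing.isZmodMorphism.Build {poly F} {poly F} eqn_op eqn_op_is_zmod_morphism.

Lemma lower_add_raise_comb (c d : nat) f g (h := c%:R * f - d%:R * g) :
  lower h + raise h =
  c%:R * (lower f + raise f) - d%:R * (lower g + raise g).
Proof.
by rewrite /h /lower /raise !(derivB, derivM, deriv_nat); ring.
Qed.

(** Each eigenvector of [E + F] is sent to its two neighbours, and the link to
either of them is cut by one value of [x]: this is what makes finite solutions
easy to find in this basis.  Predecessors are harmless at [0] because of the
factors [p] and [q] in front. *)
Lemma eqn_op_eigenvec p q : (p + q)%N = n -> eqn_op (eigenvec p q) =
  p%:R * (p%:R - q%:R - 1 - x)%:P * eigenvec p.-1 q.+1
  - q%:R * (p%:R - q%:R + 1 + x)%:P * eigenvec p.+1 q.-1.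
Proof.
move=> pqn.
rewrite eqn_opE /= lower_sub_raise_eigenvec //.
rewrite lower_add_raise_comb weight_eigenvec //.
have E1 : p%:R * (lower (eigenvec p.-1 q.+1) + raise (eigenvec p.-1 q.+1)) =
   p%:R * ((p%:R - q%:R - 2) * eigenvec p.-1 q.+1).
  case: p pqn => [|p] pqn; first by rewrite !mul0r.
  by rewrite lower_add_raise_eigenvec /= -?addSnnS // -!natr1; ring.
have E2 : q%:R * (lower (eigenvec p.+1 q.-1) + raise (eigenvec p.+1 q.-1)) =
   q%:R * ((p%:R - q%:R + 2) * eigenvec p.+1 q.-1).
  case: q pqn {E1} => [|q] pqn; first by rewrite !mul0r.
  by rewrite lower_add_raise_eigenvec /= ?addSnnS // -!natr1; ring.
rewrite E1 E2 !(polyCB, polyCD) !polyC_natr; ring.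
Qed.
End Equation.

(** * An explicit polynomial solution for special parameters *)

Section Solution.
Variables (F : numFieldType) (k i : nat).
Hypothesis le_ik : (2 * i <= k)%N.

(** Solves the two-term relation [sol_wtS] imposed by [eqn_op_eigenvec].  In the
extreme case [k = 2i], at [j = i], the true upper index of the second binomial is
[-1]; truncation makes it [0], and the value at lower index [0] is [1] anyway. *)
Definition sol_wt j : nat := 'C(k, j) * 'C(k - i - 1 - j, i - j).

Lemma sol_wtS j : (j < i)%N ->
  (sol_wt j * ((k - j) * (i - j)) = sol_wt j.+1 * (j.+1 * (k - i - j.+1)))%N.
Proof.
move=> ltji; rewrite /sol_wt.
have := mul_bin_left k j; have := mul_bin_diag (k - i - 1 - j) (i - j.+1).
have -> : ((k - i - 1 - j).-1 = k - i - 1 - j.+1)%N by lia.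
have -> : ((i - j.+1).+1 = i - j)%N by lia.
have -> : (k - i - j.+1 = k - i - 1 - j)%N by lia.
nia.
Qed.

Definition sol : {poly F} :=
  \sum_(j < i.+1) eigenvec F (k.*2 - j.*2) j.*2 *+ sol_wt j.

Lemma eqn_op_sol_eq0 : eqn_op k.*2 ((k.*2 - 4 * i)%:R - 1) sol = 0.
Proof.
rewrite /sol raddf_sum /=; set x := _ - 1.
have jk (j : 'I_i.+1) : (j.*2 <= k.*2)%N by have := ltn_ord j; lia.
under eq_bigr => j _ do rewrite raddfMn /= eqn_op_eigenvec ?subnK ?jk // mulrnBl.
(* The downward term at [j = i] and the upward term at [j = 0] vanish; what is
   left cancels in pairs, downward from [j] against upward from [j + 1]. *)
rewrite sumrB big_ord_recr big_ord_recl /= !mul0r !mul0rn add0r.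
have -> : (k.*2 - i.*2)%:R - i.*2%:R - 1 - x = 0 :> F.
  by rewrite /x -!mul2n !natrB ?natrM; [ring|lia|lia].
rewrite mulr0 mul0r mul0rn addr0 -sumrB big1 // => j _.
rewrite add0n (_ : bump 0 j = j.+1) //.
have ltji := ltn_ord j.
have -> : (k.*2 - j.+1.*2).+1 = (k.*2 - j.*2).-1 by lia.
have -> : (k.*2 - j.*2)%:R - j.*2%:R - 1 - x = (4 * (i - j))%:R.
  by rewrite /x -!mul2n !natrM !natrB ?natrM; [ring|lia..].
have -> : (k.*2 - j.+1.*2)%:R - j.+1.*2%:R + 1 + x = (4 * (k - i - j.+1))%:R.
  by rewrite /x -!mul2n !natrM !natrB ?natrM; [ring|lia..].
rewrite !polyC_natr -!natrM -!mulrnAl -!mulrnA -mulrBl.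
rewrite [X in _ - X%:R](_ : _ = (k.*2 - j.*2) * (4 * (i - j)) * sol_wt j)%N.
  by rewrite subrr mul0r.
have := sol_wtS ltji.
rewrite -!doubleB; nia.
Qed.

Lemma coef0_eigenvec p q : (eigenvec F p q)`_0 = 1.
Proof.
by rewrite -horner_coef0 /eigenvec hornerM !horner_exp !hornerE subr0 !expr1n mulr1.
Qed.

Lemma sol_coef0_neq0 : sol`_0 != 0.
Proof.
rewrite /sol coef_sum; under eq_bigr => j _ do rewrite coefMn coef0_eigenvec.
rewrite -natr_sum pnatr_eq0 -lt0n (bigD1 ord_max) //=.
(* The weight at [j = i] is the positive number [binomial(k, i)]. *)
by rewrite addn_gt0 /sol_wt subnn bin0 muln1 bin_gt0; lia.
Qed.

Lemma lead_coef_eigenvec p q : ~~ odd q -> (eigenvec F p q)`_(p + q) = 1.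
Proof.
move=> oddq.
have -> : eigenvec F p q = ('X - (-1)%:P) ^+ p * ('X - 1%:P) ^+ q.
  rewrite /eigenvec -[X in _ ^+ p * X ^+ q]opprB exprNn -signr_odd (negPf oddq).
  by rewrite mul1r polyCN opprK addrC.
have mX c m : ('X - c%:P : {poly F}) ^+ m \is monic.
  exact/monic_exp/monicXsubC.
have /monicP : ('X - (-1)%:P) ^+ p * ('X - 1%:P) ^+ q \is @monic F by exact: rpredM.
by rewrite lead_coefE size_Mmonic ?monic_neq0 // !size_exp_XsubC addnS.
Qed.

Lemma sol_lead : sol`_k.*2 = sol`_0.
Proof.
rewrite /sol !coef_sum; apply: eq_bigr => j _; rewrite !coefMn.
have jk : (j.*2 <= k.*2)%N by have := ltn_ord j; lia.
rewrite -{2}(subnK jk) lead_coef_eigenvec ?odd_double //.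
by rewrite coef0_eigenvec.
Qed.
End Solution.

(** * Values of the determinants *)

(** The coefficient of [t^j] in the equation links [f_(j-2)], [f_j] and
[f_(j+2)], so a solution is determined on even degrees by [f_0]. *)
Lemma coef_solution (F : numFieldType) n (x : F) f j :
  eqn_op n x f = 0 -> f`_j.*2 * j.*2`!%:R = f`_0 * P j x n%:R.
Proof.
move=> eq0.
elim/nat_ind2: j => [||j IH0 IH1]; first by rewrite P0.
  rewrite P1; have /(congr1 (fun g : {poly F} => g`_0)) := eq0.
  rewrite /eqn_op coefB (coefB (lower _)) coefCM !coef_lower coef_raise0.
  rewrite coef_weight coef0 => E; apply/subr0_eq/(etrans _ E).
  rewrite (_ : 1.*2 = 2%N) // (_ : 2`! = 2%N) //.
  ring.
have /(congr1 (fun g : {poly F} => g`_j.*2.+2)) := eq0.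
rewrite /eqn_op coefB (coefB (lower _)) coefCM !coef_lower !coef_raiseS.
rewrite coef_weight coef0 => E.
rewrite P_recurrence mulrDr !(mulrCA f`_0) -IH0 -IH1.
have {}E := congr1 (fun z => (j.*2.+2)`!%:R * z) E; rewrite /= mulr0 in E.
apply/subr0_eq/(etrans _ E); rewrite /a !doubleS !factS !natrM -!natr1 -mul2n.
move: (f`_(2 * j).+4) (f`_(2 * j).+2) (f`_(2 * j)) => f4 f2 f0.
move: ((2 * j)`!%:R : F) => c; rewrite natrM.
by field.
Qed.

Lemma P_at_special_points (F : numFieldType) k i : (2 * i <= k)%N ->
  P k ((k.*2 - 4 * i)%:R - 1 : F) k.*2%:R = k.*2`!%:R.
Proof.
move=> le_ik; apply: (mulfI (sol_coef0_neq0 F le_ik)).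
by rewrite -(coef_solution _ (eqn_op_sol_eq0 F le_ik)) sol_lead.
Qed.

(** The order [k = l.*2] is even, so [P k] is an even function of [x] of degree
at most [k], and the [k/2 + 1] special points and their opposites are too many
zeros for [P k - n!]. *)
Lemma P_even_order (F : numFieldType) l (x : F) :
  P l.*2 x l.*2.*2%:R = l.*2.*2`!%:R.
Proof.
pose k := l.*2; pose pt i : F := (k.*2 - 4 * i)%:R - 1.
have [q sq Eq] := P_polynomial (k.*2%:R : F) k.
pose r := [seq pt i | i <- iota 0 l.+1] ++ [seq - pt i | i <- iota 0 l.+1].
suff: q - (k.*2`!%:R)%:P = 0.
  by move=> /(congr1 (fun g => g.[x])); rewrite !hornerE -Eq => /subr0_eq.
apply: (@roots_geq_poly_eq0 _ _ r).
- have root_pt i : i \in iota 0 l.+1 -> (q.[pt i] = k.*2`!%:R).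
    by rewrite mem_iota -Eq => Hi; rewrite P_at_special_points // /k; lia.
  rewrite all_cat !all_map; apply/andP; split; apply/allP => i /root_pt Hi /=;
    rewrite rootE !hornerE.
    by rewrite Hi subrr.
  by rewrite -Eq P_opp Eq Hi -signr_odd odd_double mul1r subrr.
- have ptI : {in iota 0 l.+1 &, injective pt}.
    move=> i j; rewrite !mem_iota => Hi Hj /addIr/eqP.
    by rewrite eqr_nat /k => /eqP; lia.
  rewrite cat_uniq !map_inj_in_uniq ?iota_uniq //; last first.
    by move=> i j Hi Hj /oppr_inj; apply: ptI.
  rewrite andbT; apply/hasPn => _ /mapP[i Hi ->]; apply/mapP => -[j Hj].
  (* Equality would give [(n - 4i) + (n - 4j) = 2], but [n] is divisible by 4. *)
  move=> /eqP; rewrite -subr_eq0.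
  rewrite (_ : _ - _ = 2%:R - ((k.*2 - 4 * i) + (k.*2 - 4 * j))%:R); last first.
    by rewrite /pt natrD; ring.
  rewrite subr_eq0 eqr_nat /k => /eqP; lia.
- rewrite size_cat !size_map !size_iota (leq_trans (size_polyD _ _)) //.
  rewrite geq_max size_polyN size_polyC; apply/andP; split; last first.
    by case: eqP => _ /=; lia.
  by rewrite (leq_trans sq) // /k; lia.
Qed.

Theorem corollary1p23 (R : realType) (n : nat) (hn : ~~ odd n) :
  (n = 0 %[mod 4] ->
     forall s : complex R, P (F := complex R) n./2 s n%:R = n`!%:R) /\
  (n = 2 %[mod 4] ->
     forall m : nat, (m <= n.-1)%N -> m = 1 %[mod 4] ->
       P (F := complex R) n./2 m%:R n%:R = n`!%:R /\
       P (F := complex R) n./2 (- m%:R) n%:R = - n`!%:R).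
Proof.
have n2 : n = n./2.*2 by lia.
split=> [n0 s|n2' m lemn m1].
  have -> : n = n./2./2.*2.*2 by lia.
  by rewrite doubleK; exact: P_even_order.
have Pm : P n./2 (m%:R : complex R) n%:R = n`!%:R.
  (* With [i = (n - m - 1) / 4], the special point [n - 4i - 1] is [m]. *)
  have := @P_at_special_points (complex R) n./2 ((n - m.+1) %/ 4).
  rewrite -n2 (_ : (n - 4 * _)%N = m.+1); last by lia.
  by rewrite -natr1 addrK; apply; lia.
split=> //; rewrite P_opp Pm -signr_odd.
have -> : odd n./2 by lia.
by rewrite mulN1r.
Qed.
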